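(* For every stream $s$: if $\mathcal{F}\,(\mathcal{G}\,\mathit{blue})\,s$ (i.e. $s$ is eventually all blue), then there exists $n\in\mathbb{N}$ such that $\mathit{le}_n\,s$ (i.e. $s$ is boundedly red).
   Context: The statement is to be proved constructively (intuitionistic type theory with inductive and coinductive definitions; no excluded middle, no Markov's principle). A color is one of $R$ (red), $B$ (blue). A stream is an element of the coinductive type whose only constructor forms $c\,s$ from a color $c$ and a stream $s$; streams are considered up to bisimilarity (equivalently, functions $\mathbb{N}\to\{R,B\}$ up to pointwise equality). $\mathit{blue}\,s$ means that $s=B\,s'$ for some $s'$. For a stream predicate $X$: $\mathcal{F}\,X$ is defined inductively by the rules: $X\,s$ implies $\mathcal{F}\,X\,s$; $\mathcal{F}\,X\,s$ implies $\mathcal{F}\,X\,(c\,s)$ for any color $c$. $\mathcal{G}\,X$ is defined coinductively by the rule: $X\,(c\,s)$ and $\mathcal{G}\,X\,s$ imply $\mathcal{G}\,X\,(c\,s)$. The relation $\mathit{le}_n\,s$ (''$s$ has fewer than $n$ red positions'') is defined coinductively by the rules: $\mathit{le}_{n+1}\,s$ implies $\mathit{le}_{n+1}\,(B\,s)$; $\mathit{le}_n\,s$ implies $\mathit{le}_{n+1}\,(R\,s)$. There is no rule for $\mathit{le}_0$, so $\mathit{le}_0\,s$ is always false. *)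

(* Defs.v *)
From Stdlib Require Import Streams.

Inductive color : Set := R | B.

(* Streams are the library's coinductive [Stream color].  No quotient by
   bisimilarity ([EqSt]) is needed: every predicate below whose parameter
   respects [EqSt] respects it too. *)
Definition stream : Set := Stream color.

Definition stream_pred : Type := stream -> Prop.

Definition blue : stream_pred := fun s => exists s' : stream, s = Cons B s'.

Inductive F (X : stream_pred) : stream_pred :=
| F_here : forall s, X s -> F X s
| F_later : forall c s, F X s -> F X (Cons c s).

CoInductive G (X : stream_pred) : stream_pred :=
| G_cons : forall c s, X (Cons c s) -> G X s -> G X (Cons c s).

(* [le_red n s]: [s] has strictly fewer than [n] red positions.  The bound is
   strict despite the name, so [le_red 0] has no constructor. *)
CoInductive le_red : nat -> stream_pred :=
| le_red_B : forall n s, le_red (S n) s -> le_red (S n) (Cons B s)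
| le_red_R : forall n s, le_red n s -> le_red (S n) (Cons R s).

(* Main.v *)
Require Import Defs.

(** An all-blue tail has no red position, hence strict bound 1, by coinduction. Induction on the
    finite prefix before that tail carries the bound back to [s]: a red head raises it by one, a
    blue head keeps it. *)

Lemma le_red_1_of_G_blue : forall s : stream, G blue s -> le_red 1 s.
Proof.
  cofix IH.
  intros s [c t [s' Heq] Ht].
  injection Heq as -> _.
  apply le_red_B, IH, Ht.
Qed.

Theorem lemma4p1 : forall s : stream, F (G blue) s -> exists n : nat, le_red n s.
Proof.
  intros s Hs.
  induction Hs as [s Hs | [|] s _ [n Hn]].
  - exists 1. apply le_red_1_of_G_blue, Hs.
  - exists (S n). apply le_red_R, Hn.
  (* [le_red_B] needs a successor bound; [n = 0] is impossible because [le_red 0] has no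
     constructor. *)
  - destruct n as [|n]; [inversion Hn |].
    exists (S n). apply le_red_B, Hn.
Qed.
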